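(* For every $n\in\mathbb{N}$, every triangulation on $n$ points in the plane contains $O(\alpha^n)$ $x$-monotone paths and $O(n\alpha^n)$ monotone paths, where $\alpha=1.8392\ldots$ is the unique real root of $x^3-x^2-x-1=0$.
   Context: A triangulation on a point set is a plane straight-line graph on it (straight-line edges, no two intersecting except at common endpoints) to which no further straight-line edge can be added without creating a crossing. A path $(w_1,\dots,w_t)$ in such a graph is monotone in direction $\mathbf{u}\in\mathbb{R}^2\setminus\{\mathbf{0}\}$ if $\langle \overrightarrow{w_iw_{i+1}},\mathbf{u}\rangle>0$ for $i=1,\dots,t-1$; it is $x$-monotone if it is monotone in direction $(1,0)$, and monotone if it is monotone in some direction. *)

(* Defs.v *)
From HB Require Import structures.
From mathcomp Require Import all_boot all_order all_algebra.
From mathcomp Require Import boolp classical_sets reals.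

Set Implicit Arguments.
Unset Strict Implicit.
Unset Printing Implicit Defensive.

Import Order.TTheory GRing.Theory Num.Theory.
Local Open Scope ring_scope.

(* A point set of size n is an injective p : 'I_n -> R * R; a straight-line
   graph on it is a symmetric irreflexive relation e on the indices. *)

Definition dotp (R : realType) (u v : R * R) : R := u.1 * v.1 + u.2 * v.2.

Definition segment (R : realType) (a b : R * R) : set (R * R) :=
  [set x | exists2 t : R, 0 <= t <= 1 &
    x = ((1 - t) * a.1 + t * b.1, (1 - t) * a.2 + t * b.2)]%classic.

(* The last-but-one clause is the usual convention that an edge of a plane
   graph contains no vertex besides its endpoints; it follows from the last
   one except for isolated vertices. *)
Definition plane_straight_line_graph (R : realType) (n : nat)
    (p : 'I_n -> R * R) (e : rel 'I_n) : Prop :=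
  [/\ symmetric e,
      irreflexive e,
      forall u v w : 'I_n, e u v -> segment (p u) (p v) (p w) ->
        w = u \/ w = v
    & forall u v x y : 'I_n, e u v -> e x y ->
        [set u; v]%SET != [set x; y]%SET ->
        (segment (p u) (p v) `&` segment (p x) (p y) `<=`
          [set p u; p v] `&` [set p x; p y])%classic].

Definition add_edge (n : nat) (e : rel 'I_n) (u v : 'I_n) : rel 'I_n :=
  [rel x y | e x y || ([set x; y]%SET == [set u; v]%SET)].

Definition triangulation (R : realType) (n : nat)
    (p : 'I_n -> R * R) (e : rel 'I_n) : Prop :=
  plane_straight_line_graph p e /\
  forall u v : 'I_n, u != v -> ~~ e u v ->
    ~ plane_straight_line_graph p (add_edge e u v).

(* [sorted r w] says that r holds between consecutive entries of w. *)
Definition graph_path (n : nat) (e : rel 'I_n) (w : seq 'I_n) : bool :=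
  [&& w != [::], uniq w & sorted e w].

Definition monotone_in (R : realType) (n : nat) (p : 'I_n -> R * R)
    (u : R * R) (w : seq 'I_n) : bool :=
  sorted [rel i j | 0 < dotp (p j - p i) u] w.

Definition x_monotone (R : realType) (n : nat) (p : 'I_n -> R * R)
    (w : seq 'I_n) : bool :=
  monotone_in p (1, 0) w.

Definition monotone (R : realType) (n : nat) (p : 'I_n -> R * R)
    (w : seq 'I_n) : Prop :=
  exists2 u : R * R, u != 0 & monotone_in p u w.

(* Paths have distinct vertices, so [n.-bseq 'I_n] contains all of them.
   A path and its reverse count separately. *)
Definition num_x_monotone_paths (R : realType) (n : nat)
    (p : 'I_n -> R * R) (e : rel 'I_n) : nat :=
  #|[set w : n.-bseq 'I_n | graph_path e w && x_monotone p w]|.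

Definition num_monotone_paths (R : realType) (n : nat)
    (p : 'I_n -> R * R) (e : rel 'I_n) : nat :=
  #|[set w : n.-bseq 'I_n | graph_path e w && `[< monotone p w >]]|.

(* Main.v *)
(* Order the vertices by a sweep direction and count the increasing paths that
   end at a fixed vertex z.  If F v is the number of those starting at v, then
   F v is the sum of F over the out-neighbours of v, while planarity bounds the
   number of edges spanned by any m vertices by 3m.  Going through the vertices
   away from z, the total of F over any k of the first m of them is at most
   alpha^m lam^s psi(k), where s is the number of edges still unused out of 3m;
   this survives the addition of a vertex of arbitrary out-degree.  Three
   out-edges per vertex is the extremal case, which is where
   alpha^3 = alpha^2 + alpha + 1 comes from.

   A monotone path in direction u increases lexicographically along
   (d rotated by a quarter turn, d), d being its most clockwise edge vector, so
   the O(n) edges of the graph supply all the sweep directions needed. *)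

Require Import Defs.
From mathcomp Require Import all_boot all_order all_algebra.
From mathcomp Require Import boolp classical_sets reals.
From mathcomp Require Import zify ring lra.

Set Implicit Arguments.
Unset Strict Implicit.
Unset Printing Implicit Defensive.

Import Order.TTheory GRing.Theory Num.Theory.
Local Open Scope ring_scope.

(** * Weights *)

Section Weights.
Variable R : realFieldType.
Implicit Types a : R.

(* [lam] and [psi] are a solution of the system in [psi_step] below.  The values
   up to 3 are forced to be proportional to 1, 1 + 1/a, 1 + 1/a + 1/a^2;
   [lam] has to lie between 0.9127 and 0.9196. *)
Definition lam : R := 11 / 12.

Definition psi a (k : nat) : R :=
  match k with
  | 0 => 0 | 1 => 1 | 2 => a ^+ 2 - a | 3 => a | 4 => 12 / 11 * a
  | 5 => 211 / 100 | _ => 23 / 10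
  end.

Definition tribonacci_constant a :=
  a ^+ 3 - a ^+ 2 - a - 1 = 0 /\ 1839 / 1000 <= a <= 184 / 100.

Lemma lam_exp_le (m n : nat) : (m <= n)%N -> lam ^+ n <= lam ^+ m.
Proof. by move=> mn; apply: ler_wiXn2l mn; rewrite /lam; lra. Qed.

Lemma lam_exp_gt0 n : 0 < lam ^+ n.
Proof. by apply: exprn_gt0; rewrite /lam; lra. Qed.

Section Tribonacci.
Variable a : R.
Hypothesis ha : tribonacci_constant a.

Lemma psi_ge0 k : 0 <= psi a k.
Proof.
case: ha => _ /andP[a1 a2].
have a_sq : a <= a ^+ 2 by apply: ler_eXnr => //; lra.
case: k => [|[|[|[|[|[|k]]]]]] /=; lra.
Qed.

Lemma psi_le k : psi a k <= 23 / 10.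
Proof.
case: ha => _ /andP[a1 a2].
have a_sq : a ^+ 2 <= 4 by rewrite expr2; nra.
case: k => [|[|[|[|[|[|k]]]]]] /=; lra.
Qed.

(** Here [d] is the number of out-neighbours of a newly added vertex and [k] the number of other
    vertices summed over. The cubic equation gives equality at [d = 3], [k <= 2]. From 6 on [psi] is
    constant while [lam ^+ d] decreases, so finitely many cases remain. *)
Lemma psi_step d k :
  lam ^+ d * (psi a d + psi a k) <= a * lam ^+ 3 * psi a k.+1.
Proof.
case: ha => a0 /andP[a1 a2].
have b1 : 338 / 100 <= a ^+ 2 by rewrite expr2; nra.
have b2 : a ^+ 2 <= 3386 / 1000 by rewrite expr2; nra.
have a3 : a ^+ 3 = a ^+ 2 + a + 1 by lra.
have a3' : a * a ^+ 2 = a ^+ 2 + a + 1 by rewrite -a3; ring.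
have [d6|d6] := leqP 6 d.
  have -> : psi a d = 23 / 10.
    by move: d6; do 6?[case: d => [|d] //].
  apply: (@le_trans _ _ (lam ^+ 6 * (23 / 10 + psi a k))).
    by apply: ler_wpM2r (lam_exp_le d6); have := psi_ge0 k; lra.
  have ak : a * psi a k.+1 >= lam ^+ 3 * (23 / 10 + psi a k).
    rewrite /lam; case: k => [|[|[|[|[|[|k]]]]]] /=; lra.
  have -> : lam ^+ 6 = lam ^+ 3 * lam ^+ 3 by rewrite -exprD.
  rewrite -mulrA -[leRHS]mulrA [leRHS]mulrCA ler_pM2l ?lam_exp_gt0 //.
rewrite /lam.
case: d d6 => [|[|[|[|[|[|d]]]]]] //= _; case: k => [|[|[|[|[|[|k]]]]]] /=; lra.
Qed.

(** Covers a sweep step whose new vertex is not among those summed over. *)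
Lemma a_lam3_ge1 d : lam ^+ d <= a * lam ^+ 3.
Proof.
case: ha => _ /andP[a1 a2].
by apply: (le_trans (lam_exp_le (leq0n d))); rewrite /lam; lra.
Qed.

End Tribonacci.
End Weights.

(** * Increasing paths in sparse graphs *)

Section Counting.
Variables (R : realFieldType) (a : R).
Hypothesis ha : tribonacci_constant a.
Variables (n : nat) (g : rel 'I_n) (h : 'I_n -> 'I_n).
Hypothesis h_inj : injective h.
Hypothesis h_desc : forall u v, g u v -> (h v < h u)%N.

Definition edges_in (S : {set 'I_n}) : {set 'I_n * 'I_n} :=
  [set q | [&& q.1 \in S, q.2 \in S & g q.1 q.2]].

Hypothesis sparse : forall S : {set 'I_n}, (#|edges_in S| <= 3 * #|S|)%N.

(** The listed sequences omit the starting vertex [v]; [k] bounds the number of edges and serves as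
    recursion fuel. *)
Fixpoint paths_to (z : 'I_n) (k : nat) (v : 'I_n) : seq (seq 'I_n) :=
  (if v == z then [:: [::]] else [::]) ++
  (if k is k'.+1 then
     flatten [seq [seq u :: w | w <- paths_to z k' u] | u <- enum (g v)]
   else [::]).

Definition num_paths_to (z : 'I_n) (k : nat) (v : 'I_n) : nat :=
  size (paths_to z k v).

Lemma paths_to_complete z k v w :
  (size w <= k)%N -> path g v w -> last v w = z -> w \in paths_to z k v.
Proof.
elim: k v w => [|k IH] v [|u w] //=.
- by move=> _ _ ->; rewrite eqxx.
- by move=> _ _ ->; rewrite eqxx.
rewrite ltnS => wk /andP[gvu uw] wz; rewrite mem_cat; apply/orP; right.
apply/flatten_mapP; exists u; first by rewrite mem_enum.
by apply/mapP; exists w => //; exact: IH.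
Qed.

Lemma num_paths_to_rec z k v :
  num_paths_to z k.+1 v =
  ((v == z) + \sum_(u | g v u) num_paths_to z k u)%N.
Proof.
rewrite /num_paths_to /= size_cat; congr (_ + _)%N; first by case: ifP.
rewrite size_flatten /shape -map_comp sumnE big_map big_enum /=.
by apply: eq_bigr => u _; rewrite size_map.
Qed.

Lemma num_paths_to_low z k v : (h v < h z)%N -> num_paths_to z k v = 0%N.
Proof.
elim: k v => [|k IH] v hv.
  by rewrite /num_paths_to /=; case: eqP hv => // ->; rewrite ltnn.
rewrite num_paths_to_rec big1 ?addn0 => [|u /h_desc uv]; last first.
  by apply: IH; exact: ltn_trans uv hv.
by case: eqP hv => // ->; rewrite ltnn.
Qed.

(** The sweep starts at [z] itself, since vertices of smaller rank cannot reach [z]. *)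
Definition level (z : 'I_n) (m : nat) : {set 'I_n} :=
  [set v | h z <= h v < h z + m]%N.

Lemma card_level z m : (#|level z m| <= m)%N.
Proof.
rewrite -[leqRHS](size_iota (h z)) cardE -(size_map (fun v => val (h v))).
apply: uniq_leq_size.
  by rewrite map_inj_uniq ?enum_uniq // => u v /val_inj /h_inj.
move=> i /mapP[v]; rewrite mem_enum inE => hv ->.
by rewrite mem_iota.
Qed.

Lemma level_succ_none z m :
  (forall v, val (h v) != h z + m)%N -> level z m.+1 = level z m.
Proof.
move=> hv; apply/setP => v; rewrite !inE addnS ltnS.
by rewrite [(h v <= _)%N]leq_eqVlt (negbTE (hv v)).
Qed.

Lemma level_succ z m v :
  val (h v) = (h z + m)%N -> level z m.+1 = v |: level z m.
Proof.
move=> hv; apply/setP => u; rewrite !inE addnS ltnS [(h u <= _)%N]leq_eqVlt.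
case: eqP => [hu|/eqP hu] /=.
  have -> : u = v by apply: h_inj; apply: val_inj; rewrite /= hu -hv.
  by rewrite eqxx hv leq_addr.
by case: (u =P v) hu => // ->; rewrite -hv eqxx.
Qed.

Lemma card_edges_level z m v : val (h v) = (h z + m)%N ->
  (#|edges_in (level z m)| + #|[set u in level z m | g v u]|
     <= #|edges_in (level z m.+1)|)%N.
Proof.
move=> hv; have vL : v \notin level z m by rewrite inE hv ltnn andbF.
have pair_inj : injective (pair v : 'I_n -> 'I_n * 'I_n) by move=> ? ? [].
rewrite -(card_imset _ pair_inj) -cardsUI [X in (_ + X)%N]eq_card0 ?addn0.
  apply: subset_leq_card; apply/fintype.subsetP => -[x y].
  rewrite (level_succ hv) inE => /orP[|/imsetP[u]].
    rewrite inE => /and3P[/= xL yL gxy].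
    by rewrite inE /= !in_setU1 xL yL gxy !orbT.
  rewrite inE => /andP[uL gvu] [-> ->].
  by rewrite inE /= !in_setU1 eqxx uL gvu orbT.
move=> [x y]; apply/negP => /setIP[]; rewrite inE => /and3P[/= xL _ _].
by case/imsetP=> u _ [xv _]; move: vL; rewrite -xv xL.
Qed.

(* The factor [lam ^ (3 (m + 1) - #edges)] is split between the two sides (up to
   the constant [lam ^ 3]) to avoid a subtraction. *)
Lemma weighted_path_bound z k m (A : {set 'I_n}) : A \subset level z m.+1 ->
  lam R ^+ #|edges_in (level z m.+1)| * (\sum_(v in A) num_paths_to z k v)%:R
    <= a ^+ m * lam R ^+ 3 ^+ m * psi a #|A|.
Proof.
have lam0 d : 0 <= lam R ^+ d by apply/ltW/lam_exp_gt0.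
have a_ge0 : 0 <= a by case: ha => _ /andP[? ?]; lra.
have c_ge0 i : 0 <= a ^+ i * lam R ^+ 3 ^+ i by apply: mulr_ge0; exact: exprn_ge0.
elim: m k A => [|m IH] k A AL.
  rewrite !expr0 !mul1r.
  have L1 : level z 1 = [set z].
    apply/setP => v; rewrite !inE addn1 ltnS -eqn_leq.
    by apply/eqP/eqP => [/val_inj /h_inj|->].
  move: AL; rewrite L1 subset1 => /orP[]/eqP->; last first.
    by rewrite big_set0 cards0 mulr0.
  rewrite big_set1 cards1 /=.
  have -> : num_paths_to z k z = 1%N.
    case: k => [|k]; first by rewrite /num_paths_to /= eqxx.
    rewrite num_paths_to_rec eqxx big1 // => u /h_desc.
    exact: num_paths_to_low.
  by rewrite mulr1 -(expr0 (lam R)); exact: lam_exp_le.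
(* If no vertex has the next rank, the level is unchanged and the right-hand side grows by a factor
   of at least 1. *)
have [v /eqP hv|none] := pickP (fun v => val (h v) == h z + m.+1)%N; last first.
  have eqL : level z m.+2 = level z m.+1.
    by apply: level_succ_none => v; rewrite none.
  rewrite eqL in AL *.
  apply: le_trans (IH k A AL) _; apply: ler_wpM2r; first exact: psi_ge0.
  rewrite -!exprMn (exprS _ m) ler_peMl ?(a_lam3_ge1 ha 0) //.
  by rewrite exprMn c_ge0.
have vL : v \notin level z m.+1 by rewrite inE hv ltnn andbF.
set L := level z m.+1 in IH vL *.
set N := [set u in L | g v u].
set c := a ^+ m * lam R ^+ 3 ^+ m in IH.
have -> : a ^+ m.+1 * lam R ^+ 3 ^+ m.+1 = c * (a * lam R ^+ 3).
  by rewrite /c !(exprS _ m); ring.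
apply: (@le_trans _ _ (lam R ^+ (#|edges_in L| + #|N|) *
                       (\sum_(v in A) num_paths_to z k v)%:R)).
  by apply: ler_wpM2r (lam_exp_le R (card_edges_level hv)); exact: ler0n.
rewrite exprD.
(* If [v] is outside [A], only the factor [lam ^ #|N|] is new, and it is at most [a * lam ^ 3]. *)
have [vA|vA] := boolP (v \in A); last first.
  have AL' : A \subset L.
    apply/fintype.subsetP => u uA; have := fintype.subsetP AL u uA.
    by rewrite (level_succ hv) in_setU1; case: eqP uA vA => // -> ->.
  rewrite [_ * lam R ^+ #|N|]mulrC -[leLHS]mulrA.
  apply: le_trans (ler_wpM2l (lam0 _) (IH k A AL')) _.
  rewrite mulrCA -[leRHS]mulrA; apply: ler_wpM2l; first exact: c_ge0.
  by apply: ler_wpM2r; [exact: psi_ge0 | exact: a_lam3_ge1].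
have A'L : A :\ v \subset L.
  apply/fintype.subsetP => u; rewrite in_setD1 => /andP[uv uA].
  by have := fintype.subsetP AL u uA; rewrite (level_succ hv) in_setU1 (negbTE uv).
have NL : N \subset L by apply/fintype.subsetP => u; rewrite inE => /andP[].
(* Out-neighbours of [v] outside [N] rank below [z] and contribute no path. The fuel drops here, so
   the induction is over all [k]. *)
have Fv : (num_paths_to z k v <= \sum_(u in N) num_paths_to z k.-1 u)%N.
  have vz : v == z = false by apply/eqP => vz; move: hv; rewrite vz /=; lia.
  case: k => [|k]; first by rewrite /num_paths_to /= vz.
  rewrite num_paths_to_rec vz add0n /=.
  rewrite (bigID (mem N)) /= [X in (_ + X)%N]big1 ?addn0 => [|u /andP[gvu uN]].
    rewrite leq_eqVlt; apply/orP; left; apply/eqP/eq_bigl => u.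
    by rewrite !inE; case: (g v u); rewrite ?andbT ?andbF.
  apply: num_paths_to_low; have := h_desc gvu.
  rewrite -[nat_of_ord (h v)]/(val (h v)) hv => hu.
  by move: uN; rewrite !inE gvu andbT; lia.
rewrite (big_setD1 v) //= natrD (cardsD1 v A) vA add1n.
(* The induction hypothesis is used twice, for [N] and for [A] without [v]; [psi_step] combines the
   two bounds. *)
apply: (@le_trans _ _ (lam R ^+ #|N| * (c * psi a #|N| + c * psi a #|A :\ v|))).
  rewrite [_ * lam R ^+ #|N|]mulrC -[leLHS]mulrA ler_wpM2l // mulrDr lerD ?IH //.
  apply: le_trans (IH k.-1 N NL); apply: ler_wpM2l => //.
  by rewrite ler_nat.
rewrite -mulrDr mulrCA -[leRHS]mulrA ler_wpM2l ?c_ge0 //.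
exact: psi_step.
Qed.

Lemma num_paths_ending z k :
  (\sum_v num_paths_to z k v)%:R <= 3 * a ^+ (n - (h z).+1).
Proof.
have a_ge0 : 0 <= a by case: ha => _ /andP[? ?]; lra.
set m := (n - _)%N.
have hm : (h z + m.+1 = n)%N by have := ltn_ord (h z); rewrite /m; lia.
have -> : (\sum_v num_paths_to z k v = \sum_(v in level z m.+1) num_paths_to z k v)%N.
  rewrite (bigID (mem (level z m.+1))) /= [X in (_ + X)%N]big1 ?addn0 // => v.
  rewrite inE hm ltn_ord andbT -ltnNge; exact: num_paths_to_low.
have := weighted_path_bound k (subxx (level z m.+1)).
set D := #|_|; set s := (\sum_(_ in _) _)%N => bound.
have D_le : (D <= 3 + 3 * m)%N.
  by apply: leq_trans (sparse _) _; have := card_level z m.+1; lia.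
have lamm : 0 < lam R ^+ (3 * m) by exact: lam_exp_gt0.
(* Sparsity leaves the weight [lam ^ (3 * m + 3)]; after cancellation the constant is 23/10 divided
   by [lam ^ 3], which is below 3. *)
suff : lam R ^+ (3 * m) * (lam R ^+ 3 * s%:R) <= lam R ^+ (3 * m) * (a ^+ m * (23 / 10)).
  rewrite ler_pM2l // /lam => bnd; have := exprn_ge0 m a_ge0; lra.
rewrite mulrA -exprD addnC.
apply: le_trans (ler_wpM2r (ler0n _ _) (lam_exp_le R D_le)) _.
apply: le_trans bound _; rewrite -exprM [a ^+ m * _]mulrC -mulrA ler_wpM2l ?(ltW lamm) //.
by apply: ler_wpM2l; [exact: exprn_ge0 | exact: psi_le].
Qed.

Lemma card_sorted_bound (W : {set n.-bseq 'I_n}) :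
  (forall w, w \in W -> (w : seq _) != [::] /\ sorted g w) ->
  #|W|%:R <= 4 * a ^+ n.
Proof.
move=> HW.
have a_gt : 1839 / 1000 <= a by case: ha => _ /andP[].
pose ps z := flatten [seq [seq v :: w | w <- paths_to z n v] | v <- enum 'I_n].
have : (#|W| <= \sum_z \sum_v num_paths_to z n v)%N.
  have -> : (\sum_z \sum_v num_paths_to z n v =
             size (flatten [seq ps z | z <- enum 'I_n]))%N.
    rewrite size_flatten /shape -map_comp sumnE big_map big_enum /=.
    apply: eq_bigr => z _.
    rewrite size_flatten /shape -map_comp sumnE big_map big_enum /=.
    by apply: eq_bigr => v _; rewrite size_map.
  rewrite cardE -(size_map (fun w : n.-bseq 'I_n => (w : seq _))).
  apply: uniq_leq_size; first by rewrite map_inj_uniq ?enum_uniq //; exact: val_inj.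
  move=> w' /mapP[w]; rewrite mem_enum => /HW[w0 gw] ->.
  case: w w0 gw => -[|v w] //= size_w _ gw.
  apply/flatten_mapP; exists (last v w); first by rewrite mem_enum.
  apply/flatten_mapP; exists v; first by rewrite mem_enum.
  by apply/mapP; exists w => //; apply: paths_to_complete => //; exact: ltnW.
rewrite -(ler_nat R) => /le_trans; apply.
rewrite natr_sum; apply: le_trans (ler_sum _ (fun z _ => num_paths_ending z n)) _.
(* Being injective, [h] is a permutation, so the exponents run once through 0, ..., n - 1. *)
rewrite -mulr_sumr (_ : \sum_i _ = \sum_(i < n) a ^+ i); last first.
  rewrite [RHS](reindex_inj rev_ord_inj) [RHS](reindex_inj h_inj) /=.
  by apply: eq_bigr => z _; congr (_ ^+ _).
have := subrX1 a n; set S := \sum_(i < n) _ => geom.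
have S_ge0 : 0 <= S by apply: sumr_ge0 => i _; apply: exprn_ge0; lra.
(* The geometric sum costs a factor 1 / (a - 1), and 3 / (83/100) is below 4. *)
have : (83 / 100) * S <= (a - 1) * S by apply: ler_wpM2r => //; lra.
rewrite -geom; lra.
Qed.
End Counting.

(** * Plane straight-line graphs are sparse *)

(** Choosing a [Q]-partner for each element gives an injection; this serves when partners are only
    known to exist. *)
Lemma leq_card_rel (T U : finType) (A : {set T}) (B : {set U})
    (Q : T -> U -> Prop) :
  (forall x, x \in A -> exists2 u, u \in B & Q x u) ->
  (forall x y u, Q x u -> Q y u -> x = y) -> (#|A| <= #|B|)%N.
Proof.
move=> AQ Q_inj; pose f x := [pick u in B | `[< Q x u >]].
have fP x : x \in A -> exists2 u, u \in B & f x = Some u /\ Q x u.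
  move=> /AQ[u uB xu]; rewrite /f; case: pickP => [v /andP[vB /asboolP xv]|none].
    by exists v.
  by have := none u; rewrite uB /= asboolT.
have f_inj : {in A &, injective f}.
  move=> x y /fP[u _ [-> xu]] /fP[v _ [-> yv]] [uv].
  by apply: Q_inj xu _; rewrite uv.
have Some_inj' : injective (@Some U) by move=> ? ? [].
rewrite -(card_in_imset f_inj) -(card_imset B Some_inj').
apply: subset_leq_card; apply/fintype.subsetP => _ /imsetP[x /fP[u uB [-> _]] ->].
by apply/imsetP; exists u.
Qed.

(** * Edges of a noncrossing graph as graphs of affine functions *)

Section Lines.
Variables (R : realFieldType) (n : nat).
Implicit Types (X Y : 'I_n -> R) (a b c d v w : 'I_n) (s t : R) (E : rel 'I_n).

Definition slope X Y a b : R := (Y b - Y a) / (X b - X a).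

Definition line X Y a b t : R := Y a + (t - X a) * slope X Y a b.

Lemma slopeN X Y a b : slope X (\- Y) a b = - slope X Y a b.
Proof. by rewrite /slope /= -mulNr; congr (_ / _); ring. Qed.

Lemma lineN X Y a b t : line X (\- Y) a b t = - line X Y a b t.
Proof. by rewrite /line slopeN /=; ring. Qed.

Lemma line_start X Y a b : line X Y a b (X a) = Y a.
Proof. by rewrite /line subrr mul0r addr0. Qed.

Lemma line_end X Y a b : X a < X b -> line X Y a b (X b) = Y b.
Proof.
move=> ab; have : X b - X a != 0 by rewrite subr_eq0 gt_eqF.
by move=> ?; rewrite /line /slope; field.
Qed.

Lemma line_lt X Y a b c t :
  X a < t -> (line X Y a b t < line X Y a c t) = (slope X Y a b < slope X Y a c).
Proof. by move=> at_; rewrite /line ltrD2l ltr_pM2l ?subr_gt0. Qed.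

(** The abscissa [t] is interior to the first edge but may be an endpoint of the second, so an edge
    ending inside another is excluded too. *)
Definition noncrossing X Y E := forall a b c d t,
  E a b -> E c d -> (a, b) <> (c, d) -> X a < t < X b -> X c <= t <= X d ->
  line X Y a b t <> line X Y c d t.

Lemma noncrossingN X Y E : noncrossing X Y E -> noncrossing X (\- Y) E.
Proof.
move=> nc a b c d t Eab Ecd abcd tab tcd; rewrite !lineN => /oppr_inj.
exact: nc.
Qed.

(* The endpoints of [up] and [lo] are consecutive right neighbours of [a] in
   slope order, and [v] is the leftmost vertex of the wedge they span. *)
Definition gap X Y E (S : {set 'I_n}) a lo up v :=
  [/\ [/\ E a lo, E a up, slope X Y a lo < slope X Y a up &
          forall c, E a c -> ~ slope X Y a lo < slope X Y a c < slope X Y a up],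
      [/\ X a < X v, X v <= X lo & X v <= X up],
      line X Y a lo (X v) <= Y v <= line X Y a up (X v) &
      forall w, w \in S -> X a < X w < X v ->
        ~ line X Y a lo (X w) <= Y w <= line X Y a up (X w)].

Lemma gapN X Y E S a lo up v :
  gap X Y E S a lo up v -> gap X (\- Y) E S a up lo v.
Proof.
move=> [[Elo Eup lt_lu consec] [av vlo vup] /andP[v1 v2] first_v].
split=> //=.
- split=> //; first by rewrite !slopeN ltrN2.
  by move=> c Eac; rewrite !slopeN !ltrN2 andbC; exact: consec.
- by rewrite !lineN !lerN2 v1 v2.
- by move=> w wS aw; rewrite !lineN !lerN2 andbC; exact: first_v.
Qed.

Section Planar.
Variables (X Y : 'I_n -> R) (E : rel 'I_n) (S : {set 'I_n}).
Hypothesis X_inj : injective X.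
Hypothesis E_lt : forall a b, E a b -> X a < X b.
Hypothesis E_S : forall a b, E a b -> a \in S /\ b \in S.
Hypothesis nc : noncrossing X Y E.

(** The difference of the two affine functions changes sign between [s] and [t], so it vanishes at a
    point strictly between them, interior to both edges. *)
Lemma noncrossing_lt a b c d s t : E a b -> E c d ->
  X a <= s <= X b -> X a <= t <= X b -> X c <= s <= X d -> X c <= t <= X d ->
  line X Y a b s < line X Y c d s -> line X Y c d t < line X Y a b t -> False.
Proof.
move=> Eab Ecd /andP[as_ sb] /andP[at_ tb] /andP[cs sd] /andP[ct td] lts ltt.
pose D1 := line X Y c d s - line X Y a b s.
pose D2 := line X Y a b t - line X Y c d t.
have D1_gt0 : 0 < D1 by rewrite subr_gt0.
have D2_gt0 : 0 < D2 by rewrite subr_gt0.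
(* The fraction of the way from [s] to [t] at which the difference vanishes. *)
pose q := D1 / (D1 + D2).
have D_gt0 : 0 < D1 + D2 by exact: addr_gt0.
have q_gt0 : 0 < q by exact: divr_gt0.
have q_lt1 : q < 1 by rewrite ltr_pdivrMr // mul1r ltrDl.
have qD : q * (D1 + D2) = D1 by rewrite divfK // gt_eqF.
pose r := s + (t - s) * q.
have affine u v : line X Y u v r = (1 - q) * line X Y u v s + q * line X Y u v t.
  by rewrite /line /r; ring.
have r_eq : line X Y a b r = line X Y c d r.
  rewrite !affine; apply/eqP; rewrite -subr_eq0.
  have -> : (1 - q) * line X Y a b s + q * line X Y a b t -
    ((1 - q) * line X Y c d s + q * line X Y c d t) = q * (D1 + D2) - D1.
    by rewrite /D1 /D2; ring.
  by rewrite qD subrr.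
have neq : (a, b) <> (c, d) by case=> ? ?; subst c d; move: lts; rewrite ltxx.
have st : s != t.
  by apply/eqP => st; move: (lts); rewrite st => /lt_trans /(_ ltt); rewrite ltxx.
have [l lr [u ru [al cl ub ud]]] : exists2 l, l < r & exists2 u, r < u &
    [/\ X a <= l, X c <= l, u <= X b & u <= X d].
  have [st'|ts|/eqP] := ltgtP s t; last by rewrite (negbTE st).
    exists s; first by rewrite /r ltrDl mulr_gt0 ?subr_gt0.
    exists t => //; rewrite -subr_gt0.
    have -> : t - r = (t - s) * (1 - q) by rewrite /r; ring.
    by rewrite mulr_gt0 ?subr_gt0.
  exists t.
    rewrite -subr_gt0.
    have -> : r - t = (s - t) * (1 - q) by rewrite /r; ring.
    by rewrite mulr_gt0 ?subr_gt0.
  exists s => //; rewrite -subr_gt0.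
  have -> : s - r = (s - t) * q by rewrite /r; ring.
  by rewrite mulr_gt0 ?subr_gt0.
by apply: (nc Eab Ecd neq) r_eq; apply/andP; split; lra.
Qed.

(** Two edges leaving [a] with equal slope would overlap just to the right of [a]. *)
Lemma slope_inj a b c : E a b -> E a c -> slope X Y a b = slope X Y a c -> b = c.
Proof.
move=> Eab Eac eq_sl; apply/eqP/negPn/negP => /eqP bc.
have [ab ac] := (E_lt Eab, E_lt Eac).
have [t at_ [tb tc]] : exists2 t, X a < t & t < X b /\ t < X c.
  have [bc'|cb] := leP (X b) (X c).
    by exists ((X a + X b) / 2); [lra | split; lra].
  by exists ((X a + X c) / 2); [lra | split; lra].
apply: (nc (t := t) Eab Eac); last by rewrite /line eq_sl.
- by case.
- by rewrite at_.
- by rewrite !ltW.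
Qed.

(** At [X v] the edge from [c] to [up'] runs inside the wedge of [a]. If [c] lies right of [a], it
    is outside the wedge because [v] is leftmost there; if left, the edge passes above or below [a].
    Either way it crosses a side of the wedge. If [c = a], it separates two consecutive slopes. *)
Lemma gap_lt_False a lo up c lo' up' v :
  gap X Y E S a lo up v -> gap X Y E S c lo' up' v ->
  Y v < line X Y c up' (X v) -> line X Y c up' (X v) < line X Y a up (X v) ->
  False.
Proof.
move=> [[Elo Eup lt_lu consec] [av vlo vup] /andP[v1 v2] first_v].
move=> [[Elo' Eup' _ _] [cv vlo' vup'] _ _] lt_v lt_up.
have lo_v := le_lt_trans v1 lt_v.
have [ac|ca|/X_inj ac] := ltgtP (X a) (X c).
- have := first_v c (E_S Eup').1; rewrite ac cv => /(_ isT)/negP.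
  rewrite negb_and -!ltNge => /orP[lt_c|lt_c].
    apply: (noncrossing_lt (s := X c) (t := X v) Eup' Elo) ; rewrite ?line_start //;
      apply/andP; split; lra.
  apply: (noncrossing_lt (s := X c) (t := X v) Eup Eup') ; rewrite ?line_start //;
      apply/andP; split; lra.
- have neq : (c, up') <> (a, up) by case=> ? _; subst; lra.
  have : line X Y c up' (X a) <> line X Y a up (X a).
    by apply: (nc Eup' Eup neq); apply/andP; split; lra.
  move=> /eqP; rewrite line_start neq_lt => /orP[lt_a|lt_a].
    by apply: (noncrossing_lt (s := X a) (t := X v) Eup' Elo); rewrite ?line_start //;
      apply/andP; split; lra.
  by apply: (noncrossing_lt (s := X a) (t := X v) Eup Eup'); rewrite ?line_start //;
      apply/andP; split; lra.
- subst c; apply: (consec up' Eup').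
  by rewrite -!(line_lt _ _ _ av) lt_up lo_v.
Qed.

(* [up] is the edge directly above [v] on its left side, so each vertex is the
   leftmost one of at most one such gap, and by reflection of at most one gap
   whose lower edge passes strictly below it. *)
Lemma gap_inj a lo up c lo' up' v :
  gap X Y E S a lo up v -> gap X Y E S c lo' up' v ->
  Y v < line X Y a up (X v) -> Y v < line X Y c up' (X v) ->
  [/\ a = c, lo = lo' & up = up'].
Proof.
move=> g1 g2 lt1 lt2.
have [lt_up|lt_up|eq_up] := ltgtP (line X Y a up (X v)) (line X Y c up' (X v)).
- by case: (gap_lt_False g2 g1 lt1 lt_up).
- by case: (gap_lt_False g1 g2 lt2 lt_up).
case: g1 g2 => [[Elo Eup lt_lu consec] [av vlo vup] _ _].
move=> [[Elo' Eup' lt_lu' consec'] [cv vlo' vup'] _ _].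
(* As [v] is strictly below the edge to [up], it is not its endpoint, so [X v] is interior to that
   edge. *)
have vup_lt : X v < X up.
  rewrite lt_neqAle vup andbT; apply/eqP => /X_inj vE; move: lt1.
  by rewrite vE line_end ?ltxx ?E_lt.
have [eq1 eq2] : (a, up) = (c, up').
  apply: contrapT => neq; apply: (nc Eup Eup' neq _ _ eq_up); first by rewrite av.
  by rewrite vup' ltW.
subst c up'; split=> //; apply: slope_inj (Elo) (Elo') _.
have [lt_sl|lt_sl|//] := ltgtP (slope X Y a lo) (slope X Y a lo').
- by case: (consec lo' Elo'); rewrite lt_sl.
- by case: (consec' lo Elo); rewrite lt_sl.
Qed.

Lemma gap_exists a lo b : E a lo -> E a b -> slope X Y a lo < slope X Y a b ->
  exists up, exists2 v, v \in S & gap X Y E S a lo up v.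
Proof.
move=> Elo Eb lt_lb.
pose P c := E a c && (slope X Y a lo < slope X Y a c).
have Pb : P b by rewrite /P Eb.
case: (arg_minP (fun c => slope X Y a c) Pb) => up /andP[Eup lt_lu] up_min.
pose W w := [&& w \in S, X a < X w, X w <= X lo, X w <= X up &
                line X Y a lo (X w) <= Y w <= line X Y a up (X w)].
have [alo aup] := (E_lt Elo, E_lt Eup).
(* The endpoint of the shorter side, measured along [X], lies in the wedge. *)
have [w0 Ww0] : exists w, W w.
  have [le_x|lt_x] := leP (X lo) (X up).
    exists lo; rewrite /W (E_S Elo).2 alo lexx le_x line_end // lexx /=.
    by rewrite -[leLHS](line_end Y alo) ltW // line_lt.
  exists up; rewrite /W (E_S Eup).2 aup lexx (ltW lt_x) (line_end Y aup) lexx andbT /=.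
  by rewrite -[leRHS](line_end Y aup) ltW // line_lt.
case: (arg_minP X Ww0) => v /and5P[vS av vlo vup v_in] v_min.
exists up, v => //; split=> //.
- split=> // c Eac /andP[lt1 lt2].
  by have := up_min c; rewrite /P Eac lt1 leNgt lt2 => /(_ isT).
- move=> w wS /andP[aw wv] w_in.
  have : W w by rewrite /W wS aw w_in !ltW //; lra.
  by move=> /v_min; rewrite leNgt wv.
Qed.

End Planar.

(* At most one edge per left endpoint is topmost; any other edge is the lower
   side of a gap, and a vertex is leftmost in at most two gaps. *)
Lemma card_right_edges X Y E (S : {set 'I_n}) :
  injective X -> (forall a b, E a b -> X a < X b) ->
  (forall a b, E a b -> a \in S /\ b \in S) -> noncrossing X Y E ->
  (#|[set q : 'I_n * 'I_n | E q.1 q.2]| <= 3 * #|S|)%N.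
Proof.
move=> X_inj E_lt E_S nc; set ED := [set _ | _].
pose top := [set q : 'I_n * 'I_n |
  [forall c, E q.1 c ==> (slope X Y q.1 c <= slope X Y q.1 q.2)]].
have card_top : (#|ED :&: top| <= #|S|)%N.
  apply: (@leq_card_rel _ _ _ _ (fun q u => q.1 = u /\ q \in ED :&: top)).
    by move=> q qT; exists q.1 => //; move: qT; rewrite !inE => /andP[/E_S[]].
  move=> [a b] [c d] u [/= -> ab] [/= -> cd]; congr (_, _).
  move: ab cd; rewrite !inE /= => /andP[Eub /forallP top_b] /andP[Eud /forallP top_d].
  apply: (slope_inj E_lt nc Eub Eud); apply/eqP.
  by rewrite eq_le (implyP (top_b d)) // (implyP (top_d b)).
have card_rest : (#|ED :\: top| <= #|S| * 2)%N.
  rewrite -card_bool -cardsT -cardsX.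
  (* The boolean tells whether the leftmost vertex is strictly below the upper side; otherwise it is
     on that side, hence strictly above the lower one. *)
  apply: (@leq_card_rel _ _ _ _ (fun q (u : 'I_n * bool) =>
    exists2 up, gap X Y E S q.1 q.2 up u.1 &
      if u.2 then Y u.1 < line X Y q.1 up (X u.1)
      else line X Y q.1 q.2 (X u.1) < Y u.1)).
    move=> [a lo]; rewrite !inE /= => /andP[/forallPn[b]].
    rewrite negb_imply -ltNge => /andP[Eab lt_b] Elo.
    have [up [v vS gv]] := gap_exists E_lt E_S Elo Eab lt_b.
    have [lt_up|ge_up] := ltP (Y v) (line X Y a up (X v)).
      by exists (v, true); [rewrite !inE vS | exists up].
    exists (v, false); first by rewrite !inE vS.
    exists up => //=; case: gv => [[_ _ lt_lu _] [av _ _] _ _].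
    by apply: lt_le_trans ge_up; rewrite line_lt.
  move=> [a lo] [c lo'] [v []] [up g1 lt1] [up' g2 lt2] /=.
    by have [/= -> -> _] := gap_inj X_inj E_lt E_S nc g1 g2 lt1 lt2.
  have below u w : line X Y u w (X v) < Y v ->
      (\- Y) v < line X (\- Y) u w (X v) by rewrite lineN ltrN2.
  by have [/= -> _ ->] := gap_inj X_inj E_lt E_S (noncrossingN nc) (gapN g1)
       (gapN g2) (below _ _ lt1) (below _ _ lt2).
by have := cardsID top ED; lia.
Qed.

End Lines.

(** * Shearing the points to distinct abscissas *)

Lemma exists_nonroot (R : numDomainType) (q : {poly R}) :
  q != 0 -> exists x, ~~ root q x.
Proof.
move=> q0; pose s := [seq k%:R : R | k <- iota 0 (size q)].
have [s_root|] := boolP (all (root q) s); last by case/allPn=> x _; exists x.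
have s_uniq : uniq s.
  by rewrite map_inj_uniq ?iota_uniq // => i j /eqP; rewrite eqr_nat => /eqP.
by have := max_poly_roots q0 s_root s_uniq; rewrite size_map size_iota ltnn.
Qed.

(** Each pair of distinct points rules out at most one [c], the root of a nonzero polynomial of
    degree at most 1; a non-root of the product of these polynomials works for all pairs. *)
Lemma exists_injective_shear (R : realFieldType) n (p : 'I_n -> R * R) :
  injective p -> exists c, injective (fun i => (p i).1 + c * (p i).2).
Proof.
move=> p_inj.
pose f (q : 'I_n * 'I_n) : {poly R} :=
  ((p q.1).1 - (p q.2).1)%:P + ((p q.1).2 - (p q.2).2) *: 'X.
have : \prod_(q | q.1 != q.2) f q != 0.
  apply/prodf_neq0 => -[i j] /= ij; apply/eqP => f0.
  have c0 : (f (i, j))`_0 = 0 by rewrite f0 coef0.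
  have c1 : (f (i, j))`_1 = 0 by rewrite f0 coef0.
  move: c0 c1; rewrite /f /= !coefD !coefC !coefZ !coefX /=.
  rewrite mulr0 mulr1 addr0 add0r => /eqP + /eqP; rewrite !subr_eq0 => /eqP e1 /eqP e2.
  by move/eqP: ij; apply; apply: p_inj; case: (p i) (p j) e1 e2 => ? ? [? ?] /= -> ->.
case/exists_nonroot => c; rewrite /root horner_prod => /prodf_neq0 nz; exists c.
move=> i j eq_ij; apply/eqP/negPn/negP => ij.
have := nz (i, j) ij; rewrite /f /= hornerD hornerC hornerZ hornerX.
by move/eqP; apply; lra.
Qed.

Lemma sqr_norm_gt0 (R : realDomainType) (u : R * R) :
  u != 0 -> 0 < u.1 ^+ 2 + u.2 ^+ 2.
Proof.
move=> u0; rewrite lt0r paddr_eq0 ?sqr_ge0 // !sqrf_eq0 addr_ge0 ?sqr_ge0 // andbT.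
by apply: contra u0; case: u => ? ? /= /andP[/eqP -> /eqP ->].
Qed.

Section PlaneGraph.
Variables (R : realType) (n : nat) (p : 'I_n -> R * R) (e : rel 'I_n).
Hypothesis p_inj : injective p.
Hypothesis plane : plane_straight_line_graph p e.

Definition sheared_edge (c : R) (S : {set 'I_n}) : rel 'I_n := [rel u v |
  [&& u \in S, v \in S, e u v & (p u).1 + c * (p u).2 < (p v).1 + c * (p v).2]].

(** Subtracting [c * y] undoes the shear. *)
Lemma line_in_segment (X := fun c i => (p i).1 + c * (p i).2) (c t : R) a b :
  X c a < X c b -> X c a <= t <= X c b ->
  let y := line (X c) (fun i => (p i).2) a b t in
  segment (p a) (p b) (t - c * y, y).
Proof.
move=> ab /andP[at_ tb] /=.
have ab0 : X c b - X c a != 0 by rewrite subr_eq0 gt_eqF.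
exists ((t - X c a) / (X c b - X c a)).
  by rewrite divr_ge0 ?subr_ge0 ?(ltW ab) // ler_pdivrMr ?subr_gt0 // mul1r lerB.
move: ab0; rewrite /line /slope /X => ab0.
by congr (_, _); field.
Qed.

Lemma sheared_noncrossing c S :
  noncrossing (fun i => (p i).1 + c * (p i).2) (fun i => (p i).2)
    (sheared_edge c S).
Proof.
case: plane => _ _ _ cross a b a' b' t.
case/and4P=> _ _ eab lt_ab /and4P[_ _ eab' lt_ab'] neq /andP[at_ tb] t' line_eq.
have t_ab : (p a).1 + c * (p a).2 <= t <= (p b).1 + c * (p b).2 by rewrite !ltW.
have := line_in_segment lt_ab' t'; have := line_in_segment lt_ab t_ab.
rewrite /= -line_eq; set z := (_, _) => z1 z2.
have sets_neq : [set a; b]%SET != [set a'; b']%SET.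
  apply/eqP => sets_eq; apply: neq.
  have : a \in [set a'; b']%SET by rewrite -sets_eq !inE eqxx.
  have : b \in [set a'; b']%SET by rewrite -sets_eq !inE eqxx orbT.
  rewrite !inE => /orP[]/eqP Eb /orP[]/eqP Ea; rewrite ?Ea ?Eb //.
  - by move: lt_ab; rewrite Ea Eb ltxx.
  - by move: lt_ab; rewrite Ea Eb lt_gtF.
  - by move: lt_ab; rewrite Ea Eb ltxx.
have [[]] := cross _ _ _ _ eab eab' sets_neq z (conj z1 z2).
  by move=> /= zE _; move: at_; rewrite -zE /=; lra.
by move=> /= zE _; move: tb; rewrite -zE /=; lra.
Qed.

(** Reorienting each edge from left to right in sheared coordinates is injective because [g] never
    contains an edge in both directions. *)
Lemma plane_sparse (g : rel 'I_n) (S : {set 'I_n}) :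
  subrel g e -> (forall u v, g u v -> ~~ g v u) ->
  (#|edges_in g S| <= 3 * #|S|)%N.
Proof.
move=> ge g_anti.
have [c X_inj] := exists_injective_shear p_inj.
have e_sym : symmetric e by case: plane.
have E_lt a b : sheared_edge c S a b ->
  (p a).1 + c * (p a).2 < (p b).1 + c * (p b).2 by case/and4P.
have E_S a b : sheared_edge c S a b -> a \in S /\ b \in S by case/and4P.
apply: leq_trans (card_right_edges X_inj E_lt E_S (@sheared_noncrossing c S)).
apply: (@leq_card_rel _ _ _ _ (fun q r =>
  g q.1 q.2 /\ (r = q \/ r = (q.2, q.1)))).
  move=> [u v]; rewrite inE => /and3P[/= uS vS guv].
  have e_ir : irreflexive e by case: plane.
  have [lt_uv|lt_vu|/X_inj uv] := ltgtP ((p u).1 + c * (p u).2) ((p v).1 + c * (p v).2).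
  - by exists (u, v); [rewrite inE; apply/and4P; rewrite /= ge | split=> //; left].
  - by exists (v, u); [rewrite inE; apply/and4P; rewrite /= e_sym ge | split=> //; right].
  - by move: (ge _ _ guv); rewrite uv e_ir.
move=> [u v] [u' v'] r /= [guv [->|->]] [guv' []] [? ?]; subst=> //.
all: by move: (g_anti _ _ guv'); rewrite guv.
Qed.

(** Each edge appears in both directions; splitting by index order gives two antisymmetric
    halves. *)
Lemma card_plane_edges : (#|[set q : 'I_n * 'I_n | e q.1 q.2]| <= 6 * n)%N.
Proof.
have [e_sym e_ir _ _] := plane.
pose up := [rel u v : 'I_n | e u v && (u < v)%N].
pose dn := [rel u v : 'I_n | e u v && (v < u)%N].
have up_le : (#|edges_in up [set: 'I_n]%SET| <= 3 * n)%N.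
  rewrite -[n in leqRHS]card_ord -cardsT; apply: plane_sparse => u v /=.
    by case/andP.
  by case/andP=> _ uv; rewrite negb_and -leqNgt ltnW ?orbT.
have dn_le : (#|edges_in dn [set: 'I_n]%SET| <= 3 * n)%N.
  rewrite -[n in leqRHS]card_ord -cardsT; apply: plane_sparse => u v /=.
    by case/andP.
  by case/andP=> _ uv; rewrite negb_and -leqNgt ltnW ?orbT.
have : [set q : 'I_n * 'I_n | e q.1 q.2] \subset edges_in up [set: 'I_n]%SET 
    :|: edges_in dn [set: 'I_n]%SET.
  apply/fintype.subsetP => -[u v]; rewrite !inE /= => euv; rewrite euv /=.
  by rewrite -neq_ltn; apply: contraTneq euv => /val_inj ->; rewrite e_ir.
move/subset_leq_card/leq_trans; apply.
rewrite (leq_trans (leq_card_setU _ _)) //.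
by rewrite (leq_trans (leq_add up_le dn_le)) // -mulnDl.
Qed.

(** * Sweep directions *)

(** The pair is ordered lexicographically; ties are broken along [u] turned clockwise by a quarter,
    so distinct points have distinct keys. *)
Definition sweep_key (u : R * R) (i : 'I_n) : R *l R :=
  (dotp (p i) u, dotp (p i) (u.2, - u.1)).

Definition sweep_monotone (u : R * R) : rel 'I_n :=
  [rel i j | e i j && (sweep_key u i < sweep_key u j)%O].

Lemma sweep_key_inj u : u != 0 -> injective (sweep_key u).
Proof.
move=> u0 i j [] e1 e2; apply: p_inj.
have u_gt0 := sqr_norm_gt0 u0.
move: e1 e2; rewrite /dotp /=; case: (p i) (p j) => x y [x' y'] /= e1 e2.
have ex : (u.1 ^+ 2 + u.2 ^+ 2) * (x - x') = 0.
  by transitivity (u.1 * (x * u.1 + y * u.2 - (x' * u.1 + y' * u.2)) +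
    u.2 * (x * u.2 + y * - u.1 - (x' * u.2 + y' * - u.1))); [ring | rewrite e1 e2; ring].
have ey : (u.1 ^+ 2 + u.2 ^+ 2) * (y - y') = 0.
  by transitivity (u.2 * (x * u.1 + y * u.2 - (x' * u.1 + y' * u.2)) -
    u.1 * (x * u.2 + y * - u.1 - (x' * u.2 + y' * - u.1))); [ring | rewrite e1 e2; ring].
move: ex ey => /eqP; rewrite mulf_eq0 gt_eqF //= subr_eq0 => /eqP ->.
by move=> /eqP; rewrite mulf_eq0 gt_eqF //= subr_eq0 => /eqP ->.
Qed.

Definition sweep_paths (u : R * R) : {set n.-bseq 'I_n} :=
  [set w : n.-bseq 'I_n | ((w : seq _) != [::]) && sorted (sweep_monotone u) w].

Lemma card_sweep_paths (a : R) u : tribonacci_constant a -> u != 0 ->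
  #|sweep_paths u|%:R <= 4 * a ^+ n.
Proof.
move=> ha u0; have K_inj := sweep_key_inj u0; set K := sweep_key u in K_inj.
(* The rank of a vertex is the number of vertices after it in the sweep, so it drops along every
   edge. *)
pose above v := [set w | (K v < K w)%O].
have above_lt v : (#|above v| < n)%N.
  rewrite -[n in leqRHS]card_ord -cardsT; apply: proper_card.
  by apply/properP; split; [exact: finset.subsetT | exists v; rewrite ?inE ?ltxx].
pose h v := Ordinal (above_lt v).
have h_lt u' v : (K u' < K v)%O -> (h v < h u')%N.
  move=> lt_uv; apply: proper_card; apply/properP; split.
    by apply/fintype.subsetP => w; rewrite !inE; exact: lt_trans.
  by exists v; rewrite !inE ?ltxx.
apply: (@card_sorted_bound _ _ ha _ (sweep_monotone u) h).
- move=> i j hij; apply: K_inj; apply/eqP; move: (h_lt i j) (h_lt j i).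
  rewrite hij ltnn; case: ltgtP => // _ lt_ij lt_ji.
    by case: (notF (lt_ij isT)).
  by case: (notF (lt_ji isT)).
- by move=> i j /andP[_ /h_lt].
- move=> S; apply: plane_sparse => [i j /andP[]//|i j /andP[_ lt_ij]].
  by rewrite /= negb_and -leNgt ltW ?orbT.
- by move=> w; rewrite inE => /andP[].
Qed.

End PlaneGraph.

(** * Replacing an arbitrary direction by one coming from an edge *)

Section Monotone.
Variables (R : realType) (n : nat) (p : 'I_n -> R * R) (e : rel 'I_n).

Definition ccw_turn (d : R * R) : R * R := (- d.2, d.1).

Lemma sweep_key_lt u i j : 0 < dotp (p j - p i) u ->
  (sweep_key p u i < sweep_key p u j)%O.
Proof.
rewrite /dotp /= => lt_ij; rewrite ltxi_pair; apply/andP; split.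
  by rewrite /dotp; lra.
by apply/implyP; rewrite /dotp; lra.
Qed.

(* If [d] is the most clockwise of several vectors in an open half-plane, then
   all of them weakly advance in direction [ccw_turn d]; the parallel ones
   advance in direction [d], the tie-breaking direction of [sweep_key]. *)
Lemma ccw_turn_key_lt u (d : R * R) i j :
  0 < dotp d u -> 0 < dotp (p j - p i) u ->
  0 <= dotp (p j - p i) (ccw_turn d) ->
  (sweep_key p (ccw_turn d) i < sweep_key p (ccw_turn d) j)%O.
Proof.
set w := p j - p i => du wu wd.
have w1 : w.1 = (p j).1 - (p i).1 by [].
have w2 : w.2 = (p j).2 - (p i).2 by [].
rewrite ltxi_pair; apply/andP; split.
  by move: wd; rewrite /dotp w1 w2 /=; lra.
apply/implyP => le_ji.
have wd0 : w.2 * d.1 = w.1 * d.2.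
  by move: wd le_ji; rewrite /dotp w1 w2 /=; lra.
suff : 0 < dotp w d by rewrite /dotp w1 w2 /=; lra.
(* Cross products with [u]. As [w] and [d] are parallel and both advance along [u], these have the
   same sign; the identity below then makes [dotp w d] positive. *)
pose cd := d.1 * u.2 - d.2 * u.1; pose cw := w.1 * u.2 - w.2 * u.1.
have eq_c : cw * dotp d u = cd * dotp w u.
  apply/eqP; rewrite -subr_eq0; apply/eqP.
  transitivity ((u.1 ^+ 2 + u.2 ^+ 2) * (w.1 * d.2 - w.2 * d.1)).
    by rewrite /cw /cd /dotp; ring.
  by rewrite wd0 subrr mulr0.
have cc_ge0 : 0 <= cd * cw.
  rewrite -(pmulr_lge0 _ du) -mulrA eq_c mulrA -expr2.
  by rewrite mulr_ge0 ?sqr_ge0 // ltW.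
have : 0 < (u.1 ^+ 2 + u.2 ^+ 2) * dotp w d.
  have -> : (u.1 ^+ 2 + u.2 ^+ 2) * dotp w d = dotp w u * dotp d u + cd * cw.
    by rewrite /cw /cd /dotp; ring.
  by rewrite ltr_pwDl // mulr_gt0.
rewrite pmulr_rgt0 // sqr_norm_gt0 //.
by apply: contraTneq du => ->; rewrite /dotp /= !mulr0 addr0 ltxx.
Qed.

(** By induction along the path: if the first edge is clockwise of the best later one, it takes
    over, since being counterclockwise is transitive within the open half-plane of [u]. *)
Lemma most_clockwise_edge u v w : w != [::] ->
  path [rel i j | e i j && (0 < dotp (p j - p i) u)] v w ->
  exists i j, [/\ e i j, 0 < dotp (p j - p i) u &
    path [rel k l | 0 <= dotp (p l - p k) (ccw_turn (p j - p i))] v w].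
Proof.
elim: w v => // x w IH v _ /= /andP[/andP[evx vx] xw].
have [->|w0] := eqVneq w [::].
  exists v, x; split=> //=; rewrite andbT /dotp /=; lra.
have [i [j [eij ij ij_w]]] := IH x w0 xw.
set d := p j - p i in ij ij_w *; set d' := p x - p v in vx *.
have [ge0|lt0] := leP 0 (dotp d' (ccw_turn d)).
  by exists i, j; split=> //=; rewrite ge0.
exists v, x; split=> //=; apply/andP; split.
  by rewrite -/d' /dotp /=; lra.
have : path [rel k l | (0 <= dotp (p l - p k) (ccw_turn d)) &&
                       (0 < dotp (p l - p k) u)] x w.
  rewrite path_relI ij_w /=; apply: sub_path xw => k l /=; by case/andP.
apply: sub_path => k l /= /andP[]; rewrite -/d'; set f := p l - p k => fd fu.
have : 0 <= dotp d u * dotp f (ccw_turn d').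
  (* The three-term relation between cross products of plane vectors, which yields this
     transitivity. *)
  have -> : dotp d u * dotp f (ccw_turn d') =
      - dotp d' (ccw_turn d) * dotp f u + dotp f (ccw_turn d) * dotp d' u.
    by rewrite /dotp /=; ring.
  by rewrite addr_ge0 // mulr_ge0 ?oppr_ge0 // ltW.
by rewrite pmulr_rge0.
Qed.

Lemma monotone_in_sweep (u : R * R) (w : n.-bseq 'I_n) :
  graph_path e w -> monotone_in p u w -> w \in sweep_paths p e u.
Proof.
move=> /and3P[w0 _ we] wu; rewrite inE w0 /=.
rewrite (sorted_relI e (fun i j => (sweep_key p u i < sweep_key p u j)%O)) we.
by apply: sub_sorted wu => i j; exact: sweep_key_lt.
Qed.

Lemma monotone_sweep (w : n.-bseq 'I_n) : graph_path e w -> monotone p w ->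
  w \in sweep_paths p e (1, 0) \/
  exists2 q : 'I_n * 'I_n, e q.1 q.2 /\ p q.2 - p q.1 != 0 &
    w \in sweep_paths p e (ccw_turn (p q.2 - p q.1)).
Proof.
case: w => -[|v [|x t]] sz // /and3P[_ _ we] [u u0 wu].
  (* A single-vertex path has no edge to supply a direction, so it is counted under (1, 0). *)
  by left; rewrite inE.
right; have [] := @most_clockwise_edge u v (x :: t) isT.
  by rewrite path_relI; apply/andP.
move=> i [j [eij ij turn]]; exists (i, j) => /=.
  by split=> //; apply: contraTneq ij => ->; rewrite /dotp !mul0r addr0 ltxx.
rewrite inE; change (path (sweep_monotone p e (ccw_turn (p j - p i))) v (x :: t)).
apply: (@sub_path _ [rel k l | [&& e k l, 0 < dotp (p l - p k) u &
    0 <= dotp (p l - p k) (ccw_turn (p j - p i))]]).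
  move=> k l /and3P[/= ekl kl kl']; rewrite /sweep_monotone /= ekl.
  exact: ccw_turn_key_lt ij kl kl'.
by rewrite !path_relI; apply/and3P.
Qed.

End Monotone.

Lemma card_bigcup_le (T I : finType) (A : {set I}) (F : I -> {set T}) :
  (#|\bigcup_(i in A) F i| <= \sum_(i in A) #|F i|)%N.
Proof.
elim/big_rec2: _ => [|i m B _ IH]; first by rewrite cards0.
by rewrite (leq_trans (leq_card_setU _ _)) ?leq_add2l.
Qed.

(** * Summing over the sweep directions *)

Section Bounds.
Variables (R : realType) (n : nat) (p : 'I_n -> R * R) (e : rel 'I_n) (a : R).
Hypothesis ha : tribonacci_constant a.
Hypothesis p_inj : injective p.
Hypothesis plane : plane_straight_line_graph p e.

Let e1_neq0 : (1, 0) != 0 :> R * R.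
Proof. by apply/eqP => -[/eqP]; rewrite oner_eq0. Qed.

Lemma num_x_monotone_paths_le : (num_x_monotone_paths p e)%:R <= 4 * a ^+ n.
Proof.
apply: le_trans (card_sweep_paths p_inj plane ha e1_neq0).
rewrite ler_nat; apply: subset_leq_card; apply/fintype.subsetP => w.
by rewrite inE => /andP[gw xw]; exact: monotone_in_sweep.
Qed.

Lemma num_monotone_paths_le : (num_monotone_paths p e)%:R <= 28 * (n%:R * a ^+ n).
Proof.
have a_ge0 : 0 <= a by case: ha => _ /andP[? _]; lra.
pose ED := [set q : 'I_n * 'I_n | e q.1 q.2].
pose P (q : 'I_n * 'I_n) := sweep_paths p e (ccw_turn (p q.2 - p q.1)).
have sub : [set w : n.-bseq 'I_n | graph_path e w && `[< monotone p w >]]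
    \subset sweep_paths p e (1, 0) :|: \bigcup_(q in ED) P q.
  apply/fintype.subsetP => w; rewrite inE => /andP[gw /asboolP mw].
  apply/setUP; case: (monotone_sweep gw mw) => [|[q [eq _] wq]]; [by left|right].
  by apply/finset.bigcupP; exists q; first by rewrite inE.
have e_ir : irreflexive e by case: plane.
have P_le q : q \in ED -> #|P q|%:R <= 4 * a ^+ n.
  rewrite inE => eq; apply: (card_sweep_paths p_inj plane ha).
  have : p q.2 - p q.1 != 0.
    rewrite subr_eq0; apply: contraTneq eq => /p_inj ->; by rewrite e_ir.
  apply: contra; case: (p q.2 - p q.1) => x y /eqP[] /eqP.
  by rewrite oppr_eq0 => /eqP -> ->.
(* For [n = 0] the bound is 0 and there is no path; for [n >= 1] the term for (1, 0) is absorbed,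
   giving 4 + 6 * 4 = 28. *)
have [n0|n_gt0] := posnP n.
  rewrite [num_monotone_paths _ _]eq_card0 ?mulr_ge0 ?exprn_ge0 // => w.
  by rewrite inE /graph_path -size_eq0 -leqn0 -{1}n0 size_bseq.
have n_ge1 : 1 <= n%:R :> R by rewrite ler1n.
apply: (@le_trans _ _ (4 * a ^+ n + (6 * n)%:R * (4 * a ^+ n))).
  apply: (@le_trans _ _ (#|sweep_paths p e (1, 0)%R| + \sum_(q in ED) #|P q|)%N%:R).
    rewrite ler_nat (leq_trans (subset_leq_card sub)) //.
    rewrite (leq_trans (leq_card_setU _ _)) // leq_add2l; exact: card_bigcup_le.
  rewrite natrD lerD ?(card_sweep_paths p_inj plane ha) // natr_sum.
  apply: le_trans (ler_sum _ P_le) _; rewrite sumr_const -[_ *+ #|_|]mulr_natl.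
  apply: ler_wpM2r; first by rewrite mulr_ge0 ?exprn_ge0.
  by rewrite ler_nat; exact: (card_plane_edges p_inj plane).
rewrite natrM; have an0 : 0 <= a ^+ n by exact: exprn_ge0.
have : 1 * a ^+ n <= n%:R * a ^+ n by exact: ler_wpM2r.
by lra.
Qed.

End Bounds.

Theorem theorem2 (R : realType) :
  exists alpha : R,
    [/\ forall x : R, x ^+ 3 - x ^+ 2 - x - 1 = 0 <-> x = alpha,
        1 + 8 / 10 + 3 / 10 ^+ 2 + 9 / 10 ^+ 3 + 2 / 10 ^+ 4 <= alpha
          < 1 + 8 / 10 + 3 / 10 ^+ 2 + 9 / 10 ^+ 3 + 3 / 10 ^+ 4,
        exists C : R, forall (n : nat) (p : 'I_n -> R * R) (e : rel 'I_n),
          injective p -> triangulation p e ->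
          (num_x_monotone_paths p e)%:R <= C * alpha ^+ n
      & exists C : R, forall (n : nat) (p : 'I_n -> R * R) (e : rel 'I_n),
          injective p -> triangulation p e ->
          (num_monotone_paths p e)%:R <= C * (n%:R * alpha ^+ n)].
Proof.
pose q : {poly R} := 'X ^+ 3 - 'X ^+ 2 - 'X - 1.
have qE x : q.[x] = x ^+ 3 - x ^+ 2 - x - 1.
  by rewrite /q !hornerE.
pose lo : R := 1 + 8 / 10 + 3 / 10 ^+ 2 + 9 / 10 ^+ 3 + 2 / 10 ^+ 4.
pose hi : R := 1 + 8 / 10 + 3 / 10 ^+ 2 + 9 / 10 ^+ 3 + 3 / 10 ^+ 4.
have lo_neg : q.[lo] <= 0 by rewrite qE /lo; lra.
have hi_pos : 0 < q.[hi] by rewrite qE /hi; lra.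
have lohi : lo <= hi by rewrite /lo /hi; lra.
have [|a /andP[lo_a a_hi] /rootP a_root] := @poly_ivt _ q _ _ lohi.
  by rewrite lo_neg ltW.
have a_lt : a < hi.
  by rewrite lt_neqAle a_hi andbT; apply: contraTneq hi_pos => <-; rewrite a_root ltxx.
rewrite qE in a_root.
have ha : tribonacci_constant a.
  by split=> //; apply/andP; move: lo_a a_hi; rewrite /lo /hi => ? ?; split; lra.
have [_ /andP[a1 a2]] := ha.
exists a; split.
- move=> x; split=> [x_root|->//].
  (* Dividing the cubic by [x - a] leaves a quadratic of discriminant -(3a - 5)(a + 1), negative
     since a > 5/3. *)
  have : (x - a) * (x ^+ 2 + (a - 1) * x + (a ^+ 2 - a - 1)) = 0.
    transitivity ((x ^+ 3 - x ^+ 2 - x - 1) - (a ^+ 3 - a ^+ 2 - a - 1)).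
      by ring.
    by rewrite x_root a_root subrr.
  move/eqP; rewrite mulf_eq0 subr_eq0 => /orP[/eqP //|/eqP].
  have : 0 <= (x + (a - 1) / 2) ^+ 2 by exact: sqr_ge0.
  by nra.
- by rewrite lo_a a_lt.
- exists 4 => n p e p_inj [plane _]; exact: num_x_monotone_paths_le.
- exists 28 => n p e p_inj [plane _]; exact: num_monotone_paths_le.
Qed.
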